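(* Let $D$ be a domain in $\mathbb{C}$. Let $a,b,c,d$ be smooth functions on $D$, with $a,d$ real-valued, $a>0$, and $b,c$ complex-valued, and suppose that $$u(z,w)=a(w)|z|^2+b(w)z^2+\overline{b(w)z^2}+c(w)z+\overline{c(w)z}+d(w)$$ is a plurisubharmonic solution to $\det(\partial\bar\partial u)=1$ on $\mathbb{C}\times D$. Then the Kähler metric $g=\partial\bar\partial u$ is flat on $\mathbb{C}\times D$ if and only if $b$ is holomorphic on $D$.
   Context: Coordinates on $\mathbb{C}^2$ are $(z,w)$. For a real-valued function $u$ on an open subset of $\mathbb{C}^2$, $\partial\bar\partial u$ denotes its complex Hessian, the $2\times 2$ matrix $\begin{bmatrix} u_{\bar z z} & u_{z\bar w}\\ u_{\bar z w} & u_{\bar w w}\end{bmatrix}$ of mixed second derivatives. A plurisubharmonic solution of $\det(\partial\bar\partial u)=1$ has positive definite complex Hessian, so $g_{\alpha\bar\beta}=(\partial\bar\partial u)_{\alpha\bar\beta}$ defines a Kähler metric. The metric is flat if its curvature tensor vanishes identically. *)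

(* Defs.v *)
From Stdlib Require Import Reals.
From Coquelicot Require Import Coquelicot.

Open Scope C_scope.

Definition connected {T : UniformSpace} (D : T -> Prop) : Prop :=
  forall U V : T -> Prop,
    open U -> open V ->
    (forall x, D x -> U x \/ V x) ->
    (exists x, D x /\ U x) -> (exists x, D x /\ V x) ->
    exists x, D x /\ U x /\ V x.

Definition is_domain (D : C -> Prop) : Prop :=
  open D /\ connected D /\ (exists w, D w).

Definition ex_derive_RC (f : R -> C) (t : R) : Prop :=
  ex_derive (fun s => Re (f s)) t /\ ex_derive (fun s => Im (f s)) t.

Definition Derive_RC (f : R -> C) (t : R) : C :=
  (Derive (fun s => Re (f s)) t, Derive (fun s => Im (f s)) t).

(** The restriction of [f] to the real line through [w] with direction [v];
    [v = 1] and [v = Ci] give the two real coordinate directions. *)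
Definition along (v : C) (f : C -> C) (w : C) : R -> C :=
  fun t => f (w + RtoC t * v).

Fixpoint Ck (n : nat) (D : C -> Prop) (f : C -> C) : Prop :=
  (forall w, D w -> continuous f w) /\
  match n with
  | O => True
  | S m =>
      (forall w, D w ->
         ex_derive_RC (along 1 f w) 0 /\ ex_derive_RC (along Ci f w) 0) /\
      Ck m D (fun w => Derive_RC (along 1 f w) 0) /\
      Ck m D (fun w => Derive_RC (along Ci f w) 0)
  end.

(** [smooth] is real (C-infinity) smoothness; it is meant for open [D]. *)
Definition smooth (D : C -> Prop) (f : C -> C) : Prop :=
  forall n : nat, Ck n D f.

Definition holomorphic (D : C -> Prop) (f : C -> C) : Prop :=
  forall w, D w -> ex_derive (K := C_AbsRing) (V := C_NormedModule) f w.

Definition upper_semicontinuous (Om : C * C -> Prop) (u : C * C -> R) : Prop :=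
  forall p, Om p ->
  forall eps : R, (0 < eps)%R -> locally p (fun q => (u q < u p + eps)%R).

Definition line_point (p v : C * C) (t : C) : C * C :=
  (fst p + t * fst v, snd p + t * snd v).

(** The mean of [u] over the circle is taken as the infimum of the means of
    the continuous majorants: for an upper semicontinuous [u], which need not
    be Riemann integrable, this is the Lebesgue mean. *)
Definition plurisubharmonic (Om : C * C -> Prop) (u : C * C -> R) : Prop :=
  upper_semicontinuous Om u /\
  forall p v : C * C,
    (forall t : C, (Cmod t <= 1)%R -> Om (line_point p v t)) ->
    forall phi : R -> R,
      (forall theta, continuous phi theta) ->
      (forall theta, (0 <= theta <= 2 * PI)%R ->
         (u (line_point p v (cos theta, sin theta)) <= phi theta)%R) ->
      (u p <= / (2 * PI) * RInt phi 0 (2 * PI))%R.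

Inductive coord : Set := cz | cw.

Definition sum_coord (F : coord -> C) : C := F cz + F cw.

Definition along2 (j : coord) (v : C) (f : C * C -> C) (p : C * C) : R -> C :=
  fun t =>
    match j with
    | cz => f (fst p + RtoC t * v, snd p)
    | cw => f (fst p, snd p + RtoC t * v)
    end.

Definition d_ (j : coord) (f : C * C -> C) (p : C * C) : C :=
  (Derive_RC (along2 j 1 f p) 0 - Ci * Derive_RC (along2 j Ci f p) 0) / 2.

Definition dbar (j : coord) (f : C * C -> C) (p : C * C) : C :=
  (Derive_RC (along2 j 1 f p) 0 + Ci * Derive_RC (along2 j Ci f p) 0) / 2.

(** The entry [g al be] stands for g_{al, bar be}. *)
Definition hermitian_form := coord -> coord -> C * C -> C.

Definition complex_hessian (u : C * C -> R) : hermitian_form :=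
  fun al be => d_ al (dbar be (fun q => RtoC (u q))).

Definition det (g : hermitian_form) (p : C * C) : C :=
  g cz cz p * g cw cw p - g cz cw p * g cw cz p.

(** [metric_inv g si ta] is g^{si, bar ta}, normalised by
    sum_ta g^{si, bar ta} g_{al, bar ta} = delta_{si, al}: it is the transpose
    of the inverse matrix of [g]. *)
Definition metric_inv (g : hermitian_form) (si ta : coord) (p : C * C) : C :=
  match si, ta with
  | cz, cz => g cw cw p / det g p
  | cz, cw => - g cw cz p / det g p
  | cw, cz => - g cz cw p / det g p
  | cw, cw => g cz cz p / det g p
  end.

(** The components R_{al, bar be, ga, bar de} of the curvature tensor of a
    Kaehler metric in holomorphic coordinates,
    - d_ga dbar_de g_{al, bar be}
      + g^{si, bar ta} (d_ga g_{al, bar ta}) (dbar_de g_{si, bar be});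
    up to the symmetries of the tensor they are the only ones that are not
    automatically zero. *)
Definition curvature (g : hermitian_form) (al be ga de : coord) (p : C * C) : C :=
  - d_ ga (dbar de (g al be)) p
  + sum_coord (fun si => sum_coord (fun ta =>
      metric_inv g si ta p * d_ ga (g al ta) p * dbar de (g si be) p)).

Definition flat (Om : C * C -> Prop) (g : hermitian_form) : Prop :=
  forall p, Om p -> forall al be ga de : coord, curvature g al be ga de p = 0.

Definition tube (D : C -> Prop) : C * C -> Prop := fun p => D (snd p).

(* Main.v *)
Require Import Defs.
From Stdlib Require Import Reals Lra.
From Coquelicot Require Import Coquelicot.

Open Scope C_scope.

(** Subscripts denote Wirtinger derivatives and w* the conjugate of w.

    The determinant of the Hessian of u is a quadratic polynomial in z and z*
    with coefficients depending on w. Being equal to 1, it has vanishing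
    coefficients of |z|^2 and of z ([det_coefficients]):
      a a_{ww*} = |a_w|^2 + 4 |b_{w*}|^2,
      a c_{ww*} = 2 b_{w*} (c_{w*})* + c_{w*} a_w.

    If g is flat, then b is holomorphic because a single curvature component
    detects b_{w*}: the entry g_{zz*} = a does not depend on z, the entry
    g_{zw*} has z-derivative 2 b_{w*}, and g^{ww*} = a, whence
    R_{zz*zz*} = 4 a |b_{w*}|^2 ([curvature_zzzz]).

    Conversely, let b_{w*} = 0. The two identities then say exactly that
    kappa = a_{w*} / a and mu = c_{w*} / a satisfy kappa_w = mu_w = 0. So
    s = kappa z* + mu is antiholomorphic on the tube, g_{zw*} = a s, and
    det g = 1 forces
      g_{zz*} = a,  g_{zw*} = a s,  g_{wz*} = a s*,  g_{ww*} = a |s|^2 + 1 / a.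
    Locally log a is harmonic, a = |h|^2 with h antiholomorphic, and
    g_{al be*} = sum_i A_{i be} (A_{i al})* for the antiholomorphic coframe
    A_1 = h (1, s), A_2 = (0, 1 / h); a metric of this form is flat
    ([flat_of_antiholomorphic_frame]). A global h need not exist when D is not
    simply connected, so only its logarithmic derivative kappa is used.

    Two facts of real analysis support this: mixed partial derivatives commute,
    so that the w*-derivative of an antiholomorphic function is again
    antiholomorphic, and a smooth function is complex differentiable if and
    only if its w*-derivative vanishes ([holomorphic_iff_Dwb]). *)

(** * Complex-valued functions of a real variable *)

Definition is_derive_RC (f : R -> C) (t : R) (l : C) : Prop :=
  is_derive (fun s => Re (f s)) t (Re l) /\ is_derive (fun s => Im (f s)) t (Im l).

Lemma is_derive_RC_unique f t l : is_derive_RC f t l -> Derive_RC f t = l.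
Proof.
intros [H1 H2]. unfold Derive_RC.
rewrite (surjective_pairing l).
f_equal; now apply is_derive_unique.
Qed.

Lemma Derive_RC_correct f t : ex_derive_RC f t -> is_derive_RC f t (Derive_RC f t).
Proof. intros [H1 H2]; split; now apply Derive_correct. Qed.

Lemma is_derive_RC_ex f t l : is_derive_RC f t l -> ex_derive_RC f t.
Proof. intros [H1 H2]; split; eexists; eassumption. Qed.

Lemma is_derive_RC_ext_loc f g t l :
  locally t (fun s => f s = g s) -> is_derive_RC f t l -> is_derive_RC g t l.
Proof.
intros He [H1 H2]; split;
  (eapply is_derive_ext_loc; [|eassumption]);
  apply (filter_imp _ _ (fun s E => f_equal _ E) He).
Qed.

Lemma is_derive_RC_const k t : is_derive_RC (fun _ => k) t 0.
Proof. split; exact (is_derive_const _ _). Qed.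

Lemma is_derive_RC_plus f g t l m :
  is_derive_RC f t l -> is_derive_RC g t m ->
  is_derive_RC (fun s => f s + g s) t (l + m).
Proof.
intros [F1 F2] [G1 G2]; split; simpl.
- exact (is_derive_plus _ _ _ _ _ F1 G1).
- exact (is_derive_plus _ _ _ _ _ F2 G2).
Qed.

Lemma is_derive_RC_mult f g t l m :
  is_derive_RC f t l -> is_derive_RC g t m ->
  is_derive_RC (fun s => f s * g s) t (l * g t + f t * m).
Proof.
intros [F1 F2] [G1 G2]; split; simpl.
  evar_last.
  + apply @is_derive_minus; apply (is_derive_mult (K := R_AbsRing));
      try eassumption; exact Rmult_comm.
  + unfold minus, plus, opp, mult; simpl. unfold Re, Im. ring.
- evar_last.
  + apply @is_derive_plus; apply (is_derive_mult (K := R_AbsRing));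
      try eassumption; exact Rmult_comm.
  + unfold plus, mult; simpl. unfold Re, Im. ring.
Qed.

Lemma is_derive_RC_conj f t l :
  is_derive_RC f t l -> is_derive_RC (fun s => Cconj (f s)) t (Cconj l).
Proof.
intros [F1 F2]; split; simpl.
- exact F1.
- exact (is_derive_opp _ _ _ F2).
Qed.

Lemma norm2_neq_0 (z : C) : z <> 0 -> (Re z ^ 2 + Im z ^ 2 <> 0)%R.
Proof.
intros Hz H. apply Hz. rewrite <- Cmod2_alt in H.
apply Cmod_eq_0. nra.
Qed.

Lemma is_derive_RC_inv f t l :
  is_derive_RC f t l -> f t <> 0 ->
  is_derive_RC (fun s => / f s) t (- l * / f t * / f t).
Proof.
intros [F1 F2] H0. pose proof (norm2_neq_0 _ H0) as Hn.
assert (HN : is_derive (fun s => (Re (f s) ^ 2 + Im (f s) ^ 2)%R) t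
               (2 * Re (f t) * Re l + 2 * Im (f t) * Im l)%R).
{ evar_last.
  - apply @is_derive_plus; apply is_derive_pow; eassumption.
  - unfold plus; simpl; ring. }
split.
- evar_last.
  + exact (is_derive_div _ _ _ _ _ F1 HN Hn).
  + simpl. unfold Re, Im in *. field. contradict Hn. rewrite <- Hn. ring.
- evar_last.
  + exact (is_derive_div _ _ _ _ _ (is_derive_opp _ _ _ F2) HN Hn).
  + unfold opp; simpl. unfold Re, Im in *. field.
    contradict Hn. rewrite <- Hn. ring.
Qed.

(** * Partial derivatives and the classes C^k on the plane *)

Definition pd (v : C) (f : C -> C) (w : C) : C := Derive_RC (along v f w) 0.

Lemma along_0 v f w : along v f w 0 = f w.
Proof. unfold along. f_equal. ring. Qed.

Lemma locally_along (P : C -> Prop) v w :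
  locally w P -> locally 0%R (fun t => P (w + RtoC t * v)).
Proof.
intros HP.
assert (Hc : forall x y : R, continuous (fun t : R => (x + t * y)%R) 0%R).
{ intros x y. apply (continuous_plus (V := R_NormedModule)).
  - apply continuous_const.
  - apply (continuous_mult (K := R_AbsRing)).
    + apply continuous_id.
    + apply continuous_const. }
assert (H : filterlim (fun t : R => w + RtoC t * v) (locally 0%R) (locally w)).
{ apply filterlim_ext with
    (fun t : R => ((fst w + t * fst v)%R, (snd w + t * snd v)%R)).
  { intros t. apply injective_projections; simpl; ring. }
  apply filterlim_locally. intros eps.
  pose proof (proj1 (filterlim_locally _ _) (Hc (fst w) (fst v)) eps) as H1.
  pose proof (proj1 (filterlim_locally _ _) (Hc (snd w) (snd v)) eps) as H2.
  rewrite Rmult_0_l, Rplus_0_r in H1. rewrite Rmult_0_l, Rplus_0_r in H2.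
  generalize (filter_and _ _ H1 H2). apply filter_imp.
  intros t [A B]; split; assumption. }
exact (H _ HP).
Qed.

Lemma is_derive_RC_along_ext D v f g w l :
  open D -> D w -> (forall x, D x -> f x = g x) ->
  is_derive_RC (along v f w) 0 l -> is_derive_RC (along v g w) 0 l.
Proof.
intros HD Hw He. apply is_derive_RC_ext_loc.
generalize (locally_along D v w (HD w Hw)). apply filter_imp.
intros t Ht. now apply He.
Qed.

Lemma pd_ext D v f g w :
  open D -> D w -> (forall x, D x -> f x = g x) -> pd v f w = pd v g w.
Proof.
intros HD Hw He.
assert (H : locally 0%R (fun t => along v f w t = along v g w t)).
{ generalize (locally_along D v w (HD w Hw)). apply filter_imp.
  intros t Ht. now apply He. }
unfold pd, Derive_RC. f_equal; apply Derive_ext_loc;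
  apply (filter_imp _ _ (fun s E => f_equal _ E) H).
Qed.

Lemma continuous_Rplus (f g : C -> R) w :
  continuous f w -> continuous g w -> continuous (fun x => f x + g x)%R w.
Proof. exact (continuous_plus (V := R_NormedModule) f g w). Qed.

Lemma continuous_Rmult (f g : C -> R) w :
  continuous f w -> continuous g w -> continuous (fun x => f x * g x)%R w.
Proof. exact (continuous_mult (K := R_AbsRing) f g w). Qed.

Lemma continuous_Ropp (f : C -> R) w :
  continuous f w -> continuous (fun x => - f x)%R w.
Proof. exact (continuous_opp (V := R_NormedModule) f w). Qed.

Lemma continuous_C (f : C -> C) w :
  continuous f w <->
  continuous (fun x => Re (f x)) w /\ continuous (fun x => Im (f x)) w.
Proof.
split.
- intros H; split.
  + apply (continuous_comp f fst _ H). destruct (f w). apply continuous_fst.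
  + apply (continuous_comp f snd _ H). destruct (f w). apply continuous_snd.
- intros [H1 H2].
  apply filterlim_locally. intros eps.
  generalize (filter_and _ _ (proj1 (filterlim_locally _ _) H1 eps)
                (proj1 (filterlim_locally _ _) H2 eps)).
  apply filter_imp. intros x [A B]; split; assumption.
Qed.

Lemma Ck_ext n D f g :
  open D -> (forall x, D x -> f x = g x) -> Ck n D f -> Ck n D g.
Proof.
intros HD. revert f g.
assert (Hcont : forall f g : C -> C, (forall x, D x -> f x = g x) ->
          (forall w, D w -> continuous f w) -> forall w, D w -> continuous g w).
{ intros f g He H w Hw. apply (continuous_ext_loc _ f).
  - generalize (HD w Hw). apply filter_imp. exact He.
  - now apply H. }
induction n as [|n IH]; intros f g He [Hc Hr]; split;
  try now apply (Hcont f g).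
{ exact I. }
destruct Hr as [Hd [Hx Hy]]. split; [|split].
- intros w Hw. destruct (Hd w Hw) as [A B].
  split; eapply is_derive_RC_ex, is_derive_RC_along_ext; try eassumption;
    apply Derive_RC_correct; eassumption.
- apply (IH (pd 1 f)); [|exact Hx]. intros w Hw. now apply (pd_ext D).
- apply (IH (pd Ci f)); [|exact Hy]. intros w Hw. now apply (pd_ext D).
Qed.

Lemma Ck_pred n D f : Ck (S n) D f -> Ck n D f.
Proof.
revert f. induction n as [|n IH]; intros f [Hc [Hd [Hx Hy]]]; split; trivial.
split; [exact Hd|split; now apply IH].
Qed.

Lemma Ck_derivable n D f (v w : C) :
  Ck (S n) D f -> v = 1 \/ v = Ci -> D w ->
  is_derive_RC (along v f w) 0 (pd v f w).
Proof.
intros [_ [Hd _]] Hv Hw. destruct (Hd w Hw) as [A B].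
destruct Hv as [->| ->]; now apply Derive_RC_correct.
Qed.

Lemma Ck_pd n D f (v : C) : Ck (S n) D f -> v = 1 \/ v = Ci -> Ck n D (pd v f).
Proof. intros [_ [_ [Hx Hy]]] [->| ->]; [exact Hx|exact Hy]. Qed.

(** The derivatives of sums, products and inverses are known by closed formulas
    on [D] only; since [D] is open, this is enough to recognise the partial
    derivatives in the definition of [Ck]. *)
Lemma Ck_S n D f (f' : C -> C -> C) :
  open D -> (forall w, D w -> continuous f w) ->
  (forall v w : C, v = 1 \/ v = Ci -> D w -> is_derive_RC (along v f w) 0 (f' v w)) ->
  (forall v : C, v = 1 \/ v = Ci -> Ck n D (f' v)) ->
  Ck (S n) D f.
Proof.
intros HD Hc Hd Hf. split; [exact Hc|split].
- intros w Hw. split; eapply is_derive_RC_ex; [apply (Hd 1 w)|apply (Hd Ci w)]; tauto.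
- split; (eapply Ck_ext; [exact HD| |apply Hf]).
  + intros w Hw. symmetry. apply is_derive_RC_unique, (Hd 1 w); tauto.
  + tauto.
  + intros w Hw. symmetry. apply is_derive_RC_unique, (Hd Ci w); tauto.
  + tauto.
Qed.

Lemma Ck_const n (D : C -> Prop) k : open D -> Ck n D (fun _ => k).
Proof.
intros HD. revert k. induction n as [|n IH]; intros k.
- split; trivial. intros w _. apply continuous_const.
- apply (Ck_S n D _ (fun _ _ => 0) HD).
  + intros w _. apply continuous_const.
  + intros v w _ _. apply is_derive_RC_const.
  + intros v _. apply IH.
Qed.

Lemma Ck_plus n D f g :
  open D -> Ck n D f -> Ck n D g -> Ck n D (fun w => f w + g w).
Proof.
intros HD. revert f g.
assert (Hc : forall (f g : C -> C) w, continuous f w -> continuous g w ->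
               continuous (fun w => f w + g w) w).
{ intros f g w Hf Hg.
  destruct (proj1 (continuous_C f w) Hf), (proj1 (continuous_C g w) Hg).
  apply continuous_C; split; now apply continuous_Rplus. }
induction n as [|n IH]; intros f g Hf Hg.
- split; trivial. intros w Hw. apply Hc; [now apply Hf|now apply Hg].
- apply (Ck_S n D _ (fun v w => pd v f w + pd v g w) HD).
  + intros w Hw. apply Hc; [now apply Hf|now apply Hg].
  + intros v w Hv Hw.
    apply (is_derive_RC_plus (along v f w) (along v g w));
      eapply Ck_derivable; eassumption.
  + intros v Hv. apply IH; now apply Ck_pd.
Qed.

Lemma Ck_mult n D f g :
  open D -> Ck n D f -> Ck n D g -> Ck n D (fun w => f w * g w).
Proof.
intros HD. revert f g.
assert (Hc : forall (f g : C -> C) w, continuous f w -> continuous g w ->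
               continuous (fun w => f w * g w) w).
{ intros f g w Hf Hg.
  destruct (proj1 (continuous_C f w) Hf), (proj1 (continuous_C g w) Hg).
  apply continuous_C; split; apply continuous_Rplus;
    try apply continuous_Ropp; now apply continuous_Rmult. }
induction n as [|n IH]; intros f g Hf Hg.
- split; trivial. intros w Hw. apply Hc; [now apply Hf|now apply Hg].
- apply (Ck_S n D _ (fun v w => pd v f w * g w + f w * pd v g w) HD).
  + intros w Hw. apply Hc; [now apply Hf|now apply Hg].
  + intros v w Hv Hw.
    rewrite <- (along_0 v f w), <- (along_0 v g w) at 1.
    apply (is_derive_RC_mult (along v f w) (along v g w));
      eapply Ck_derivable; eassumption.
  + intros v Hv. apply Ck_plus; [exact HD| |]; apply IH;
      try (now apply Ck_pd); now apply Ck_pred.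
Qed.

Lemma Ck_inv n (D : C -> Prop) (f : C -> C) :
  open D -> (forall w, D w -> f w <> 0) -> Ck n D f -> Ck n D (fun w => / f w).
Proof.
intros HD H0.
assert (Hc : Ck 0 D f -> forall w, D w -> continuous (fun w => / f w) w).
{ intros Hf w Hw. destruct (proj1 (continuous_C f w) (proj1 Hf w Hw)) as [H1 H2].
  assert (HN : continuous (fun w => / (Re (f w) ^ 2 + Im (f w) ^ 2))%R w).
  { apply (continuous_comp (fun w => (Re (f w) ^ 2 + Im (f w) ^ 2)%R) Rinv).
    - assert (Hsq : forall g : C -> R,
                continuous g w -> continuous (fun x => g x ^ 2)%R w).
      { intros g Hg. exact (continuous_Rmult _ _ _ Hg
          (continuous_Rmult _ _ _ Hg (continuous_const 1%R w))). }
      exact (continuous_Rplus _ _ _ (Hsq _ H1) (Hsq _ H2)).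
    - apply continuous_Rinv. apply norm2_neq_0. now apply H0. }
  apply continuous_C; split; apply continuous_Rmult; trivial.
  now apply continuous_Ropp. }
induction n as [|n IH]; intros Hf.
- split; trivial. now apply Hc.
- apply (Ck_S n D _ (fun v w => (-(1)) * pd v f w * / f w * / f w) HD).
  + apply Hc. split; trivial. apply Hf.
  + intros v w Hv Hw.
    replace (- (1) * pd v f w) with (- pd v f w) by ring.
    rewrite <- (along_0 v f w) at 1 2.
    apply (is_derive_RC_inv (along v f w)).
    * eapply Ck_derivable; eassumption.
    * rewrite along_0. now apply H0.
  + intros v Hv. apply Ck_pred in Hf as Hf'.
    repeat apply Ck_mult; auto using Ck_const, Ck_pd.
Qed.

(** * Wirtinger derivatives in one variable *)

Definition Dw (f : C -> C) (w : C) : C := (pd 1 f w - Ci * pd Ci f w) / 2.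
Definition Dwb (f : C -> C) (w : C) : C := (pd 1 f w + Ci * pd Ci f w) / 2.

Lemma Cconj_RtoC (x : R) : Cconj x = x.
Proof. apply injective_projections; simpl; ring. Qed.

Lemma Ci_sqr : Ci * Ci = -(1).
Proof. apply injective_projections; simpl; ring. Qed.

Lemma pd_1_wirtinger f w : pd 1 f w = Dw f w + Dwb f w.
Proof. unfold Dw, Dwb. field. Qed.

Lemma pd_Ci_wirtinger f w : pd Ci f w = Ci * (Dw f w - Dwb f w).
Proof.
unfold Dw, Dwb.
replace (_ * _) with (- (Ci * Ci) * pd Ci f w) by field.
rewrite Ci_sqr. ring.
Qed.

Lemma smooth_Dw D f : open D -> smooth D f -> smooth D (Dw f).
Proof.
intros HD Hf n.
apply (Ck_ext n D (fun w => (pd 1 f w + - Ci * pd Ci f w) * / 2)); trivial.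
{ intros w _. unfold Dw. field. }
apply Ck_mult; auto using Ck_const. apply Ck_plus; trivial.
- apply Ck_pd; auto.
- apply Ck_mult; auto using Ck_const. apply Ck_pd; auto.
Qed.

Lemma smooth_Dwb D f : open D -> smooth D f -> smooth D (Dwb f).
Proof.
intros HD Hf n.
apply (Ck_ext n D (fun w => (pd 1 f w + Ci * pd Ci f w) * / 2)); trivial.
apply Ck_mult; auto using Ck_const. apply Ck_plus; trivial.
- apply Ck_pd; auto.
- apply Ck_mult; auto using Ck_const. apply Ck_pd; auto.
Qed.

Lemma smooth_div (D : C -> Prop) (f g : C -> C) :
  open D -> (forall w, D w -> g w <> 0) -> smooth D f -> smooth D g ->
  smooth D (fun w => f w / g w).
Proof.
intros HD H0 Hf Hg n. apply Ck_mult; [exact HD|apply Hf|now apply Ck_inv].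
Qed.

(** * Equality of mixed derivatives *)

Lemma is_derive_along_1 (h : C -> R) w l :
  is_derive (fun s => h (w + RtoC s * 1)) 0%R l <->
  is_derive (fun x => h (x, snd w)) (fst w) l.
Proof.
split; intros H.
- evar_last.
  + apply (is_derive_ext (fun x => h (w + RtoC (x - fst w)%R * 1))).
    * intros x. f_equal. apply injective_projections; simpl; ring.
    * apply (is_derive_comp (fun s => h (w + RtoC s * 1)) (fun x => x - fst w)%R).
      -- replace (fst w - fst w)%R with 0%R by ring. exact H.
      -- auto_derive; trivial.
  + exact (Rmult_1_l l).
- evar_last.
  + apply (is_derive_ext (fun s => h ((fst w + s)%R, snd w))).
    * intros x. f_equal. apply injective_projections; simpl; ring.
    * apply (is_derive_comp (fun x => h (x, snd w)) (fun s => fst w + s)%R).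
      -- rewrite Rplus_0_r. exact H.
      -- auto_derive; trivial.
  + exact (Rmult_1_l l).
Qed.

Lemma is_derive_along_Ci (h : C -> R) w l :
  is_derive (fun s => h (w + RtoC s * Ci)) 0%R l <->
  is_derive (fun y => h (fst w, y)) (snd w) l.
Proof.
split; intros H.
- evar_last.
  + apply (is_derive_ext (fun y => h (w + RtoC (y - snd w)%R * Ci))).
    * intros y. f_equal. apply injective_projections; simpl; ring.
    * apply (is_derive_comp (fun s => h (w + RtoC s * Ci)) (fun y => y - snd w)%R).
      -- replace (snd w - snd w)%R with 0%R by ring. exact H.
      -- auto_derive; trivial.
  + exact (Rmult_1_l l).
- evar_last.
  + apply (is_derive_ext (fun s => h (fst w, (snd w + s)%R))).
    * intros y. f_equal. apply injective_projections; simpl; ring.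
    * apply (is_derive_comp (fun y => h (fst w, y)) (fun s => snd w + s)%R).
      -- rewrite Rplus_0_r. exact H.
      -- auto_derive; trivial.
  + exact (Rmult_1_l l).
Qed.

Definition real_part (r : C -> R) : Prop := r = Re \/ r = Im.

Lemma is_derive_RC_part (r : C -> R) f t l : real_part r ->
  is_derive_RC f t l -> is_derive (fun s => r (f s)) t (r l).
Proof. intros [->| ->] [H1 H2]; assumption. Qed.

Lemma pd_1_part n D (r : C -> R) f (w : C) : real_part r -> Ck (S n) D f -> D w ->
  is_derive (fun x => r (f (x, snd w))) (fst w) (r (pd 1 f w)).
Proof.
intros Hr Hf Hw. apply (is_derive_along_1 (fun w => r (f w))).
apply (is_derive_RC_part r (along 1 f w)); trivial.
apply (Ck_derivable n D); auto.
Qed.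

Lemma pd_Ci_part n D (r : C -> R) f (w : C) : real_part r -> Ck (S n) D f -> D w ->
  is_derive (fun y => r (f (fst w, y))) (snd w) (r (pd Ci f w)).
Proof.
intros Hr Hf Hw. apply (is_derive_along_Ci (fun w => r (f w))).
apply (is_derive_RC_part r (along Ci f w)); trivial.
apply (Ck_derivable n D); auto.
Qed.

Lemma continuous_part (r : C -> R) (f : C -> C) w : real_part r ->
  continuous f w -> continuous (fun x => r (f x)) w.
Proof. intros [->| ->] H; now apply (proj1 (continuous_C f w)). Qed.

(** The classical theorem of Schwarz, applied to the real or imaginary part [r]
    of [f]. *)
Lemma pd_comm_part D (r : C -> R) f w : real_part r ->
  open D -> Ck 2 D f -> D w -> r (pd 1 (pd Ci f) w) = r (pd Ci (pd 1 f) w).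
Proof.
intros Hr HD Hf Hw.
pose proof (Ck_pd 1 D f 1 Hf (or_introl eq_refl)) as Hf1.
pose proof (Ck_pd 1 D f Ci Hf (or_intror eq_refl)) as Hfi.
assert (E1 : forall w, D w -> Derive (fun x => r (f (x, snd w))) (fst w) = r (pd 1 f w)).
{ intros w' Hw'. apply is_derive_unique. now apply (pd_1_part 1 D). }
assert (Ei : forall w, D w -> Derive (fun y => r (f (fst w, y))) (snd w) = r (pd Ci f w)).
{ intros w' Hw'. apply is_derive_unique. now apply (pd_Ci_part 1 D). }
assert (D1i : forall w, D w ->
  is_derive (fun x => Derive (fun y => r (f (x, y))) (snd w)) (fst w)
    (r (pd 1 (pd Ci f) w))).
{ intros [x y] Hxy. simpl.
  apply (is_derive_ext_loc (fun x => r (pd Ci f (x, y)))).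
  - destruct (HD _ Hxy) as [eps He]. exists eps. intros x' Hx'.
    symmetry. apply (Ei (x', y)). apply He. split; [exact Hx'|apply ball_center].
  - now apply (pd_1_part 0 D r _ (x, y)). }
assert (Di1 : forall w, D w ->
  is_derive (fun y => Derive (fun x => r (f (x, y))) (fst w)) (snd w)
    (r (pd Ci (pd 1 f) w))).
{ intros [x y] Hxy. simpl.
  apply (is_derive_ext_loc (fun y => r (pd 1 f (x, y)))).
  - destruct (HD _ Hxy) as [eps He]. exists eps. intros y' Hy'.
    symmetry. apply (E1 (x, y')). apply He. split; [apply ball_center|exact Hy'].
  - now apply (pd_Ci_part 0 D r _ (x, y)). }
assert (Hcont : forall (F : R -> R -> R) (G : C -> R),
  (forall x y, D (x, y) -> F x y = G (x, y)) -> continuous G w ->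
  continuity_2d_pt F (fst w) (snd w)).
{ intros F G HFG HG. apply continuity_2d_pt_filterlim.
  apply (continuous_ext_loc (fun z : C => F (fst z) (snd z)) G (fst w, snd w)).
  - replace (fst w, snd w) with w by now destruct w.
    generalize (HD w Hw). apply filter_imp.
    intros [x y] Hxy. symmetry. now apply HFG.
  - now destruct w. }
assert (HDw : locally (fst w, snd w) D) by (destruct w; now apply HD).
rewrite <- (is_derive_unique _ _ _ (D1i w Hw)), <- (is_derive_unique _ _ _ (Di1 w Hw)).
apply (Schwarz (fun x y => r (f (x, y)))).
- apply locally_2d_locally. revert HDw. apply filter_imp.
  intros [x y] Hxy. simpl. repeat split; eexists.
  + now apply (pd_1_part 1 D r f (x, y)).
  + now apply (pd_Ci_part 1 D r f (x, y)).
  + now apply (D1i (x, y)).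
  + now apply (Di1 (x, y)).
- apply Hcont with (fun w => r (pd 1 (pd Ci f) w)).
  + intros x y Hxy. apply is_derive_unique. now apply (D1i (x, y)).
  + apply continuous_part; trivial. now apply (Ck_pd 0 D); auto.
- apply Hcont with (fun w => r (pd Ci (pd 1 f) w)).
  + intros x y Hxy. apply is_derive_unique. now apply (Di1 (x, y)).
  + apply continuous_part; trivial. now apply (Ck_pd 0 D); auto.
Qed.

Lemma pd_comm D f w :
  open D -> Ck 2 D f -> D w -> pd 1 (pd Ci f) w = pd Ci (pd 1 f) w.
Proof.
intros HD Hf Hw. apply injective_projections.
- apply (pd_comm_part D Re); trivial. now left.
- apply (pd_comm_part D Im); trivial. now right.
Qed.

(** Both sides expand into second partial derivatives, where the terms that do
    not match are the two mixed ones. *)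
Lemma Dw_Dwb_comm D f w :
  open D -> smooth D f -> D w -> Dw (Dwb f) w = Dwb (Dw f) w.
Proof.
intros HD Hf Hw.
assert (Hv : forall v1 v2 w : C, v1 = 1 \/ v1 = Ci -> v2 = 1 \/ v2 = Ci -> D w ->
  is_derive_RC (along v1 (pd v2 f) w) 0 (pd v1 (pd v2 f) w)).
{ intros v1 v2 w' H1 H2 Hw'. apply (Ck_derivable 0 D); trivial.
  now apply Ck_pd. }
assert (Hlin : forall v k : C, v = 1 \/ v = Ci ->
  pd v (fun w => (pd 1 f w + k * pd Ci f w) * / 2) w
  = (pd v (pd 1 f) w + k * pd v (pd Ci f) w) / 2).
{ intros v k H. unfold pd at 1.
  refine (eq_trans (is_derive_RC_unique _ _ _ (is_derive_RC_mult _ _ _ _ _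
    (is_derive_RC_plus _ _ _ _ _ (Hv v 1 w H (or_introl eq_refl) Hw)
      (is_derive_RC_mult _ _ _ _ _ (is_derive_RC_const k 0)
        (Hv v Ci w H (or_intror eq_refl) Hw)))
    (is_derive_RC_const (/ 2) 0))) _).
  field. }
assert (Edw : forall v, pd v (Dw f) w = pd v (fun w => (pd 1 f w + - Ci * pd Ci f w) * / 2) w).
{ intros v. apply (pd_ext D); trivial. intros x _. unfold Dw. field. }
change ((pd 1 (Dwb f) w - Ci * pd Ci (Dwb f) w) / 2
        = (pd 1 (Dw f) w + Ci * pd Ci (Dw f) w) / 2).
rewrite !Edw.
change (Dwb f) with (fun w => (pd 1 f w + Ci * pd Ci f w) * / 2).
rewrite !Hlin by auto. rewrite (pd_comm D f w); trivial. field.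
Qed.

(** * The Cauchy-Riemann equation *)

Lemma is_derive_C_eps (f : C -> C) (w l : C) :
  is_derive (K := C_AbsRing) (V := C_NormedModule) f w l <->
  forall eps : posreal,
    locally w (fun x => (Cmod (f x - f w - (x - w) * l) <= eps * Cmod (x - w))%R).
Proof.
split.
- intros [_ H] eps. apply locally_C.
  apply (H w (fun P HP => HP) eps).
- intros H. split.
  + apply is_linear_scal_l.
  + intros x Hx eps.
      assert (w = x) as <-
      by exact (is_filter_lim_locally_unique (V := AbsRing_NormedModule C_AbsRing) _ _ Hx).
    apply locally_C. apply H.
Qed.

Lemma is_derive_R_eps (f : R -> R) (l : R) :
  (forall eps : posreal,
    locally 0%R (fun t => (Rabs (f t - f 0 - t * l) <= eps * Rabs t)%R)) ->
  is_derive f 0%R l.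
Proof.
intros H. split.
- apply is_linear_scal_l.
- intros x Hx eps.
  assert (0%R = x) as <-
    by exact (is_filter_lim_locally_unique (V := R_NormedModule) _ _ Hx).
  generalize (H eps). apply filter_imp. intros t Ht.
  change (Rabs (f t - f 0 - (t - 0) * l) <= eps * Rabs (t - 0))%R.
  now rewrite (Rminus_0_r t).
Qed.

Lemma part_le_Cmod (r : C -> R) (z : C) : real_part r -> (Rabs (r z) <= Cmod z)%R.
Proof.
intros Hr. eapply Rle_trans; [|apply Rmax_Cmod].
destruct Hr as [->| ->]; [apply Rmax_l|apply Rmax_r].
Qed.

(** A complex derivative [l] acts on the increments [t * v] as the real
    derivative [v * l]. The restriction to unit vectors [v] makes the increment
    have length |t|. *)
Lemma is_derive_C_along (f : C -> C) (w l v : C) :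
  Cmod v = 1%R -> is_derive (K := C_AbsRing) (V := C_NormedModule) f w l ->
  is_derive_RC (along v f w) 0 (v * l).
Proof.
intros Hv Hf.
assert (H : forall r, real_part r ->
          is_derive (fun s => r (along v f w s)) 0%R (r (v * l))).
{ intros r Hr. apply is_derive_R_eps. intros eps.
  generalize (locally_along _ v w (proj1 (is_derive_C_eps f w l) Hf eps)).
  apply filter_imp. intros t Ht.
  replace (w + t * v - w) with (t * v) in Ht by ring.
  rewrite Cmod_mult, Hv, Cmod_R, Rmult_1_r in Ht.
  eapply Rle_trans; [|exact Ht].
  eapply Rle_trans; [|apply (part_le_Cmod r); trivial].
  apply Req_le. f_equal. rewrite along_0. unfold along.
  destruct Hr as [->| ->]; unfold Re, Im; simpl; ring. }
split; apply H; [now left|now right].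
Qed.

(** Continuity of the partial derivatives upgrades them to a total derivative. *)
Lemma differentiable_part D (r : C -> R) f w :
  real_part r -> open D -> Ck 1 D f -> D w ->
  differentiable_pt_lim (fun x y => r (f (x, y))) (fst w) (snd w)
    (r (pd 1 f w)) (r (pd Ci f w)).
Proof.
intros Hr HD Hf Hw. apply filterdiff_differentiable_pt_lim.
apply (filterdiff_ext_lin _
  (fun u : R * R => plus (scal (fst u) (r (pd 1 f w))) (scal (snd u) (r (pd Ci f w)))));
  [|now intros].
replace (pd 1 f w) with (pd 1 f (fst w, snd w)) by now destruct w.
apply (is_derive_filterdiff (fun x y => r (f (x, y))) (fst w) (snd w)
  (fun x y => r (pd 1 f (x, y)))).
- replace (fst w, snd w) with w by now destruct w.
  generalize (HD w Hw). apply filter_imp. intros [x y] Hxy.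
  now apply (pd_1_part 0 D r f (x, y)).
- now apply (pd_Ci_part 0 D).
- replace (fst w, snd w) with w by now destruct w.
  apply (continuous_ext (fun u : C => r (pd 1 f u))); [now intros [x y]|].
  apply continuous_part; trivial. now apply (Ck_pd 0 D); auto.
Qed.

(** The vanishing of [Dwb f] says that the derivative in the direction [Ci] is
    [Ci] times the one in the direction [1], that is, that the total real
    derivative is multiplication by a complex number. *)
Lemma holomorphic_iff_Dwb D f :
  open D -> smooth D f -> holomorphic D f <-> forall w, D w -> Dwb f w = 0.
Proof.
intros HD Hf. split; intros H w Hw.
- destruct (H w Hw) as [l Hl].
  pose proof (is_derive_C_along f w l 1 Cmod_1 Hl) as H1.
  pose proof (is_derive_C_along f w l Ci Cmod_Ci Hl) as H2.
  unfold Dwb, pd.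
  rewrite (is_derive_RC_unique _ _ _ H1), (is_derive_RC_unique _ _ _ H2).
  rewrite Cmult_assoc, Ci_sqr. field.
- exists (pd 1 f w). apply is_derive_C_eps. intros eps.
  assert (Ei : pd Ci f w = Ci * pd 1 f w).
  { rewrite pd_Ci_wirtinger, pd_1_wirtinger, H; trivial. ring. }
  (* The factor sqrt 2 compares the modulus with the maximum of the absolute
     values of the real and imaginary parts. *)
  assert (Hs : (0 < sqrt 2)%R) by (apply sqrt_lt_R0; lra).
  assert (He : (0 < eps / sqrt 2)%R)
    by (apply Rdiv_lt_0_compat; [apply cond_pos|exact Hs]).
  pose proof (differentiable_part D Re f w (or_introl eq_refl) HD (Hf 1%nat) Hw
                (mkposreal _ He)) as H1.
  pose proof (differentiable_part D Im f w (or_intror eq_refl) HD (Hf 1%nat) Hw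
                (mkposreal _ He)) as H2.
  apply locally_2d_locally in H1. apply locally_2d_locally in H2.
  replace (fst w, snd w) with w in H1, H2 by now destruct w.
  generalize (filter_and _ _ H1 H2). apply filter_imp. clear H1 H2.
  intros [x y] [H1 H2]. rewrite Ei in H1, H2. destruct w as [x0 y0].
  simpl in H1, H2.
  eapply Rle_trans; [apply Cmod_2Rmax|].
  apply Rle_trans with (sqrt 2 * (eps / sqrt 2 * Rmax (Rabs (x - x0)) (Rabs (y - y0))))%R.
  + apply Rmult_le_compat_l; [lra|]. apply Rmax_lub.
    * eapply Rle_trans; [|exact H1]. apply Req_le. f_equal. simpl. unfold Re; ring.
    * eapply Rle_trans; [|exact H2]. apply Req_le. f_equal. simpl. unfold Im; ring.
  + replace (sqrt 2 * _)%R with (eps * Rmax (Rabs (x - x0)) (Rabs (y - y0)))%R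
      by (field; lra).
    apply Rmult_le_compat_l; [apply Rlt_le, cond_pos|].
    apply (Rmax_Cmod ((x, y) - (x0, y0))).
Qed.

(** * Wirtinger derivatives in two variables *)

(** [A j] and [B j] are the derivatives of [f] in the [j]-th coordinate and in
    its conjugate. A relation is used because [d_] and [dbar] are total: their
    sum and product rules need differentiability, which the relation carries. *)
Definition wirtinger (f : C * C -> C) (p : C * C) (A B : coord -> C) : Prop :=
  forall j, is_derive_RC (along2 j 1 f p) 0 (A j + B j) /\
            is_derive_RC (along2 j Ci f p) 0 (Ci * (A j - B j)).

Lemma wirtinger_d f p A B j : wirtinger f p A B -> d_ j f p = A j.
Proof.
intros H. destruct (H j) as [H1 H2]. unfold d_.
rewrite (is_derive_RC_unique _ _ _ H1), (is_derive_RC_unique _ _ _ H2).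
rewrite Cmult_assoc, Ci_sqr. field.
Qed.

Lemma wirtinger_dbar f p A B j : wirtinger f p A B -> dbar j f p = B j.
Proof.
intros H. destruct (H j) as [H1 H2]. unfold dbar.
rewrite (is_derive_RC_unique _ _ _ H1), (is_derive_RC_unique _ _ _ H2).
rewrite Cmult_assoc, Ci_sqr. field.
Qed.

Lemma wirtinger_eq f p A B A' B' :
  wirtinger f p A B -> (forall j, A j = A' j) -> (forall j, B j = B' j) ->
  wirtinger f p A' B'.
Proof. intros H HA HB j. rewrite <- HA, <- HB. apply H. Qed.

Lemma along2_0 j v f p : along2 j v f p 0 = f p.
Proof.
destruct p as [z w].
destruct j; simpl; f_equal; apply injective_projections; simpl; trivial; ring.
Qed.

Lemma wirtinger_ext (Om : C * C -> Prop) f g p A B :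
  open Om -> Om p -> (forall q, Om q -> f q = g q) ->
  wirtinger f p A B -> wirtinger g p A B.
Proof.
intros HO Hp He H.
assert (Hl : forall j v, locally 0%R (fun t => along2 j v f p t = along2 j v g p t)).
{ destruct p as [z w]. destruct (HO _ Hp) as [eps Heps]. intros [|] v.
  - generalize (locally_along (fun x => ball z eps x) v z (locally_ball z eps)).
    apply filter_imp. intros t Ht. apply He, Heps. split; [exact Ht|apply ball_center].
  - generalize (locally_along (fun x => ball w eps x) v w (locally_ball w eps)).
    apply filter_imp. intros t Ht. apply He, Heps. split; [apply ball_center|exact Ht]. }
intros j. destruct (H j) as [H1 H2].
split; eapply is_derive_RC_ext_loc; try eassumption; apply Hl.
Qed.

Lemma wirtinger_const k p : wirtinger (fun _ => k) p (fun _ => 0) (fun _ => 0).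
Proof.
intros j. replace (Ci * (0 - 0)) with (RtoC 0) by ring.
replace (0 + 0) with (RtoC 0) by ring.
split; destruct j; apply is_derive_RC_const.
Qed.

Lemma wirtinger_plus f g p A B A' B' :
  wirtinger f p A B -> wirtinger g p A' B' ->
  wirtinger (fun q => f q + g q) p (fun j => A j + A' j) (fun j => B j + B' j).
Proof.
intros Hf Hg j. destruct (Hf j) as [F1 F2], (Hg j) as [G1 G2]. split.
- replace (_ + _) with ((A j + B j) + (A' j + B' j)) by ring.
  destruct j; exact (is_derive_RC_plus _ _ _ _ _ F1 G1).
- replace (_ * _) with (Ci * (A j - B j) + Ci * (A' j - B' j)) by ring.
  destruct j; exact (is_derive_RC_plus _ _ _ _ _ F2 G2).
Qed.

Lemma wirtinger_mult f g p A B A' B' :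
  wirtinger f p A B -> wirtinger g p A' B' ->
  wirtinger (fun q => f q * g q) p
    (fun j => A j * g p + f p * A' j) (fun j => B j * g p + f p * B' j).
Proof.
intros Hf Hg j. destruct (Hf j) as [F1 F2], (Hg j) as [G1 G2]. split.
- replace (_ + _) with ((A j + B j) * g p + f p * (A' j + B' j)) by ring.
  rewrite <- (along2_0 j 1 f p), <- (along2_0 j 1 g p).
  destruct j; exact (is_derive_RC_mult _ _ _ _ _ F1 G1).
- replace (_ * _) with
    ((Ci * (A j - B j)) * g p + f p * (Ci * (A' j - B' j))) by ring.
  rewrite <- (along2_0 j Ci f p), <- (along2_0 j Ci g p).
  destruct j; exact (is_derive_RC_mult _ _ _ _ _ F2 G2).
Qed.

Lemma wirtinger_conj f p A B :
  wirtinger f p A B ->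
  wirtinger (fun q => Cconj (f q)) p (fun j => Cconj (B j)) (fun j => Cconj (A j)).
Proof.
intros Hf j. destruct (Hf j) as [F1 F2]. split.
- replace (_ + _) with (Cconj (A j + B j)) by (rewrite Cplus_conj; ring).
  destruct j; exact (is_derive_RC_conj _ _ _ F1).
- replace (_ * _) with (Cconj (Ci * (A j - B j)))
    by (apply injective_projections; simpl; ring).
  destruct j; exact (is_derive_RC_conj _ _ _ F2).
Qed.

Lemma wirtinger_inv f p A B :
  wirtinger f p A B -> f p <> 0 ->
  wirtinger (fun q => / f q) p
    (fun j => - A j * / f p * / f p) (fun j => - B j * / f p * / f p).
Proof.
intros Hf H0 j. destruct (Hf j) as [F1 F2]. split.
- replace (_ + _) with (- (A j + B j) * / f p * / f p) by ring.
  rewrite <- (along2_0 j 1 f p) in H0 |- *.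
  destruct j; exact (is_derive_RC_inv _ _ _ F1 H0).
- replace (_ * _) with (- (Ci * (A j - B j)) * / f p * / f p) by ring.
  rewrite <- (along2_0 j Ci f p) in H0 |- *.
  destruct j; exact (is_derive_RC_inv _ _ _ F2 H0).
Qed.

Definition in_z (x : C) (j : coord) : C := match j with cz => x | cw => 0 end.
Definition in_w (x : C) (j : coord) : C := match j with cz => 0 | cw => x end.

Lemma wirtinger_z p : wirtinger (fun q => fst q) p (in_z 1) (fun _ => 0).
Proof.
assert (H : forall v, is_derive_RC (fun t => fst p + RtoC t * v) 0 v).
{ intros v. split; simpl; auto_derive; trivial; unfold Re, Im; ring. }
intros [|]; simpl.
- replace (1 + 0) with (RtoC 1) by ring. replace (Ci * (1 - 0)) with Ci by ring.
  split; apply H.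
- replace (0 + 0) with (RtoC 0) by ring. replace (Ci * (0 - 0)) with (RtoC 0) by ring.
  split; apply is_derive_RC_const.
Qed.

Lemma wirtinger_w D f (p : C * C) : smooth D f -> D (snd p) ->
  wirtinger (fun q => f (snd q)) p (in_w (Dw f (snd p))) (in_w (Dwb f (snd p))).
Proof.
intros Hf Hp [|]; simpl.
- replace (0 + 0) with (RtoC 0) by ring. replace (Ci * (0 - 0)) with (RtoC 0) by ring.
  split; exact (is_derive_RC_const (f (snd p)) 0).
- rewrite <- pd_1_wirtinger, <- pd_Ci_wirtinger.
  split; [exact (Ck_derivable 0 D f 1 _ (Hf 1%nat) (or_introl eq_refl) Hp)
          |exact (Ck_derivable 0 D f Ci _ (Hf 1%nat) (or_intror eq_refl) Hp)].
Qed.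

Lemma wirtinger_unique f p A B A' B' j :
  wirtinger f p A B -> wirtinger f p A' B' -> A j = A' j /\ B j = B' j.
Proof.
intros H H'. split.
- now rewrite <- (wirtinger_d _ _ _ _ j H), <- (wirtinger_d _ _ _ _ j H').
- now rewrite <- (wirtinger_dbar _ _ _ _ j H), <- (wirtinger_dbar _ _ _ _ j H').
Qed.

Lemma open_tube D : open D -> open (tube D).
Proof.
intros HD [z w] H. destruct (HD w H) as [eps He]. exists eps.
intros [z' w'] [_ Hw]. now apply He.
Qed.

Lemma Dw_real D (a : C -> C) w :
  open D -> smooth D a -> (forall x, D x -> Cconj (a x) = a x) -> D w ->
  Dw a w = Cconj (Dwb a w).
Proof.
intros HD Ha HR Hw.
pose proof (wirtinger_w D _ (RtoC 0, w) Ha Hw) as H.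
pose proof (wirtinger_conj _ _ _ _ H) as H'.
apply (wirtinger_ext (tube D) _ (fun q => a (snd q))) in H';
  [|now apply open_tube|exact Hw|].
- exact (proj1 (wirtinger_unique _ _ _ _ _ _ cw H H')).
- intros q Hq. now apply HR.
Qed.

(** * Flatness criterion *)

(** Here [k] is the conjugate logarithmic derivative of [a], so for a = |h|^2
    with [h] antiholomorphic the hypothesis says that [g] is A^* A for the
    coframe A with rows h (1, s) and (0, 1 / h). Since a d_ga-derivative falls
    only on the conjugated factors and a dbar_de-derivative only on the others,
    the second derivatives of [g] are products of first derivatives, and these
    are what the quadratic term of the curvature subtracts. *)
Lemma flat_of_antiholomorphic_frame (Om : C * C -> Prop) (g : hermitian_form)
  (a s : C * C -> C) (k t : coord -> C * C -> C) :
  open Om ->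
  (forall p, Om p -> a p <> 0) ->
  (forall p, Om p ->
     wirtinger a p (fun j => a p * Cconj (k j p)) (fun j => a p * k j p)) ->
  (forall p, Om p -> wirtinger s p (fun _ => 0) (fun j => t j p)) ->
  (forall j p, Om p -> exists B, wirtinger (k j) p (fun _ => 0) B) ->
  (forall j p, Om p -> exists B, wirtinger (t j) p (fun _ => 0) B) ->
  (forall p, Om p ->
     g cz cz p = a p /\ g cz cw p = a p * s p /\ g cw cz p = a p * Cconj (s p) /\
     g cw cw p = a p * Cconj (s p) * s p + / a p) ->
  flat Om g.
Proof.
intros HO Ha0 Ha Hs Hk Ht Hg.
(* The row (1, s), its dbar-derivatives, and the matrix unit that carries 1 / a. *)
set (sf := fun (j : coord) q => match j with cz => RtoC 1 | cw => s q end).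
set (tf := fun (j de : coord) q => match j with cz => RtoC 0 | cw => t de q end).
set (e := fun al be : coord => match al, be with cw, cw => RtoC 1 | _, _ => RtoC 0 end).
assert (Hg' : forall al be q, Om q ->
  a q * Cconj (sf al q) * sf be q + e al be * / a q = g al be q).
{ intros al be q Hq. destruct (Hg q Hq) as (E1 & E2 & E3 & E4).
  destruct al, be; simpl; rewrite ?E1, ?E2, ?E3, ?E4, ?Cconj_RtoC; ring. }
assert (Hsf : forall j q, Om q -> wirtinger (sf j) q (fun _ => 0) (fun de => tf j de q)).
{ intros [|] q Hq; [exact (wirtinger_const 1 q)|exact (Hs q Hq)]. }
assert (Htf : forall j de q, Om q -> exists B, wirtinger (tf j de) q (fun _ => 0) B).
{ intros [|] de q Hq; [exact (ex_intro _ _ (wirtinger_const 0 q))|exact (Ht de q Hq)]. }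
assert (H1 : forall al be q, Om q -> wirtinger (g al be) q
  (fun ga => a q * Cconj (k ga q) * Cconj (sf al q) * sf be q
     + a q * Cconj (tf al ga q) * sf be q - e al be * Cconj (k ga q) * / a q)
  (fun de => a q * k de q * Cconj (sf al q) * sf be q
     + a q * Cconj (sf al q) * tf be de q + - e al be * k de q * / a q)).
{ intros al be q Hq. apply (wirtinger_ext Om _ _ _ _ _ HO Hq (Hg' al be)).
  eapply wirtinger_eq.
  - apply wirtinger_plus.
    + apply wirtinger_mult; [|now apply Hsf].
      apply wirtinger_mult; [now apply Ha|]. apply wirtinger_conj. now apply Hsf.
    + apply wirtinger_mult; [apply wirtinger_const|].
      apply wirtinger_inv; [now apply Ha|now apply Ha0].
  - intros j. simpl. field. now apply Ha0.
  - intros j. simpl. rewrite Cconj_RtoC. field. now apply Ha0. }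
assert (H2 : forall al be ga de p, Om p ->
  d_ ga (dbar de (g al be)) p =
    a p * Cconj (k ga p) * k de p * Cconj (sf al p) * sf be p
    + a p * k de p * Cconj (tf al ga p) * sf be p
    + a p * Cconj (k ga p) * Cconj (sf al p) * tf be de p
    + a p * Cconj (tf al ga p) * tf be de p
    + e al be * Cconj (k ga p) * k de p * / a p).
{ intros al be ga de p Hp.
  destruct (Hk de p Hp) as [Bk Hkp]. destruct (Htf be de p Hp) as [Bt Htp].
  erewrite wirtinger_d; cycle 1.
  - apply (wirtinger_ext Om (fun q =>
      a q * k de q * Cconj (sf al q) * sf be q
     + a q * Cconj (sf al q) * tf be de q + - e al be * k de q * / a q) _ _ _ _ HO Hp).
    + intros q Hq. symmetry. now rewrite (wirtinger_dbar _ _ _ _ de (H1 al be q Hq)).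
    + apply wirtinger_plus; [apply wirtinger_plus|].
      * apply wirtinger_mult; [|exact (Hsf be p Hp)].
        apply wirtinger_mult; [|exact (wirtinger_conj _ _ _ _ (Hsf al p Hp))].
        exact (wirtinger_mult _ _ _ _ _ _ _ (Ha p Hp) Hkp).
      * apply wirtinger_mult; [|exact Htp].
        exact (wirtinger_mult _ _ _ _ _ _ _ (Ha p Hp)
                 (wirtinger_conj _ _ _ _ (Hsf al p Hp))).
      * apply wirtinger_mult; [|exact (wirtinger_inv _ _ _ _ (Ha p Hp) (Ha0 p Hp))].
        exact (wirtinger_mult _ _ _ _ _ _ _ (wirtinger_const _ _) Hkp).
  - simpl. field. now apply Ha0. }
intros p Hp al be ga de. unfold curvature, sum_coord.
rewrite H2 by exact Hp.
rewrite !(fun al be j => wirtinger_d _ _ _ _ j (H1 al be p Hp)).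
rewrite !(fun al be j => wirtinger_dbar _ _ _ _ j (H1 al be p Hp)).
specialize (Ha0 p Hp). destruct (Hg p Hp) as (E1 & E2 & E3 & E4).
assert (Hdet : det g p = 1).
{ unfold det. rewrite E1, E2, E3, E4. now field. }
unfold metric_inv. rewrite Hdet, E1, E2, E3, E4.
destruct al, be; simpl; rewrite ?Cconj_RtoC; field; trivial.
Qed.

(** * Antiholomorphic quotients and quadratic coefficients *)

Lemma Dwb_ext D f g w :
  open D -> D w -> (forall x, D x -> f x = g x) -> Dwb f w = Dwb g w.
Proof. intros HD Hw He. unfold Dwb. now rewrite !(pd_ext D _ f g w HD Hw He). Qed.

(** Exchanging the two derivatives turns the claim into the differentiation of
    the zero function. *)
Lemma Dwb_antiholomorphic D f w :
  open D -> smooth D f -> (forall x, D x -> Dw f x = 0) -> D w -> Dw (Dwb f) w = 0.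
Proof.
intros HD Hf H Hw. rewrite (Dw_Dwb_comm D); trivial.
rewrite (Dwb_ext D _ (fun _ => 0) w); trivial.
assert (E : forall v, pd v (fun _ => 0) w = 0).
{ intros v. exact (is_derive_RC_unique _ _ _ (is_derive_RC_const _ _)). }
unfold Dwb. rewrite !E. field.
Qed.

Lemma Dw_div_eq_0 (D : C -> Prop) (f g : C -> C) w :
  smooth D f -> smooth D g -> smooth D (fun w => f w / g w) -> D w -> g w <> 0 ->
  g w * Dw f w = f w * Dw g w -> Dw (fun w => f w / g w) w = 0.
Proof.
intros Hf Hg Hq Hw H0 E.
pose proof (wirtinger_w D _ (RtoC 0, w) Hf Hw) as Wf.
pose proof (wirtinger_w D _ (RtoC 0, w) Hg Hw) as Wg.
pose proof (wirtinger_w D _ (RtoC 0, w) Hq Hw) as Wq.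
pose proof (wirtinger_mult _ _ _ _ _ _ _ Wf (wirtinger_inv _ _ _ _ Wg H0)) as Wm.
refine (eq_trans (proj1 (wirtinger_unique _ _ _ _ _ _ cw Wq Wm)) _). simpl.
replace (_ + _) with ((g w * Dw f w - f w * Dw g w) * / g w * / g w) by now field.
rewrite E. ring.
Qed.

(** The values at 0, 1, -1, i, -i suffice: over the last four points the average
    of the polynomial is c11 + c00, and that of its product with the conjugate
    of z is c10. *)
Lemma quadratic_coefficients (c11 c20 c02 c10 c01 c00 : C) :
  (forall z : C, c11 * (z * Cconj z) + c20 * (z * z) + c02 * (Cconj z * Cconj z)
                 + c10 * z + c01 * Cconj z + c00 = 0) ->
  c11 = 0 /\ c10 = 0.
Proof.
intros H.
set (P := fun z : C => c11 * (z * Cconj z) + c20 * (z * z)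
   + c02 * (Cconj z * Cconj z) + c10 * z + c01 * Cconj z + c00).
assert (HP : forall z, P z = 0) by exact H.
split.
- replace c11 with ((P 1 + P (-(1)) + P Ci + P (-Ci)) / 4 - P 0).
  + rewrite !HP. field.
  + unfold P. apply injective_projections; simpl; field.
- replace c10 with ((P 1 - P (-(1)) - Ci * (P Ci - P (-Ci))) / 4).
  + rewrite !HP. field.
  + unfold P. apply injective_projections; simpl; field.
Qed.

(** * The Hessian of a real quadratic polynomial in z *)

(** The coefficients [a] and [d] are taken complex-valued so that all four are
    differentiated by the same operators; [qp_eq] makes their sum with the rest
    real. *)
Record quadratic_potential (D : C -> Prop) (a b c d : C -> C) (u : C * C -> R) : Prop := {
  qp_open : open D;
  qp_smooth_a : smooth D a;
  qp_smooth_b : smooth D b;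
  qp_smooth_c : smooth D c;
  qp_smooth_d : smooth D d;
  qp_eq : forall z w : C, D w ->
    RtoC (u (z, w)) = a w * (z * Cconj z) + (b w * (z * z) + c w * z)
                      + Cconj (b w * (z * z) + c w * z) + d w }.

Ltac wirt :=
  lazymatch goal with
  | |- wirtinger (fun q => fst q) _ _ _ => exact (wirtinger_z _)
  | |- wirtinger (fun q => @?F q + @?G q) _ _ _ =>
      refine (wirtinger_plus F G _ _ _ _ _ _ _); wirt
  | |- wirtinger (fun q => @?F q * @?G q) _ _ _ =>
      refine (wirtinger_mult F G _ _ _ _ _ _ _); wirt
  | |- wirtinger (fun q => Cconj (@?F q)) _ _ _ =>
      refine (wirtinger_conj F _ _ _ _); wirt
  | |- wirtinger (fun q => ?f (snd q)) _ _ _ =>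
      refine (wirtinger_w _ f _ _ _); [|eassumption]; eauto using smooth_Dw, smooth_Dwb
  end.

(** Term by term; conjugation exchanges the two derivatives. *)
Lemma wirtinger_u D a b c d u p :
  quadratic_potential D a b c d u -> tube D p ->
  wirtinger (fun q => RtoC (u q)) p
    (fun j => match j with
     | cz => a (snd p) * Cconj (fst p) + (b (snd p) * fst p + b (snd p) * fst p)
             + c (snd p)
     | cw => Dw a (snd p) * (fst p * Cconj (fst p))
             + (Dw b (snd p) * (fst p * fst p) + Dw c (snd p) * fst p)
             + Cconj (Dwb b (snd p) * (fst p * fst p) + Dwb c (snd p) * fst p)
             + Dw d (snd p)
     end)
    (fun j => match j with
     | cz => a (snd p) * fst p
             + Cconj (b (snd p) * fst p + b (snd p) * fst p + c (snd p))
     | cw => Dwb a (snd p) * (fst p * Cconj (fst p))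
             + (Dwb b (snd p) * (fst p * fst p) + Dwb c (snd p) * fst p)
             + Cconj (Dw b (snd p) * (fst p * fst p) + Dw c (snd p) * fst p)
             + Dwb d (snd p)
     end).
Proof.
intros [HD Ha Hb Hc Hd Hu] Hp.
apply (wirtinger_ext (tube D) (fun q =>
  a (snd q) * (fst q * Cconj (fst q))
  + (b (snd q) * (fst q * fst q) + c (snd q) * fst q)
  + Cconj (b (snd q) * (fst q * fst q) + c (snd q) * fst q) + d (snd q)));
  trivial.
{ now apply open_tube. }
{ intros [z w] Hq. symmetry. now apply Hu. }
eapply wirtinger_eq; [wirt| |]; intros [|]; simpl;
  rewrite ?Cplus_conj, ?Cmult_conj, ?Cplus_conj, ?Cmult_conj, ?Cconj_RtoC; ring.
Qed.

(** Each entry is one further derivative of the formulas for the first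
    derivatives of [u], which hold on the whole tube. *)
Lemma hessian_u D a b c d u p :
  quadratic_potential D a b c d u -> tube D p ->
  let z := fst p in let w := snd p in
  complex_hessian u cz cz p = a w /\
  complex_hessian u cz cw p
    = Dwb a w * Cconj z + (Dwb b w * z + Dwb b w * z) + Dwb c w /\
  complex_hessian u cw cz p
    = Dw a w * z + Cconj (Dwb b w * z + Dwb b w * z + Dwb c w) /\
  complex_hessian u cw cw p
    = Dw (Dwb a) w * (z * Cconj z)
      + (Dw (Dwb b) w * (z * z) + Dw (Dwb c) w * z)
      + Cconj (Dwb (Dw b) w * (z * z) + Dwb (Dw c) w * z) + Dw (Dwb d) w.
Proof.
intros HQ Hp z w. destruct (HQ) as [HD Ha Hb Hc Hd _].
assert (Hbar : forall al be F A B,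
  (forall q, tube D q -> F q = dbar be (fun q => RtoC (u q)) q) ->
  wirtinger F p A B -> complex_hessian u al be p = A al).
{ intros al be F A B HF HW. apply (wirtinger_d _ _ A B).
  apply (wirtinger_ext (tube D) F); trivial. now apply open_tube. }
assert (Vz : forall q, tube D q ->
  a (snd q) * fst q + Cconj (b (snd q) * fst q + b (snd q) * fst q + c (snd q))
  = dbar cz (fun q => RtoC (u q)) q).
{ intros q Hq. now rewrite (wirtinger_dbar _ _ _ _ cz (wirtinger_u _ _ _ _ _ _ q HQ Hq)). }
assert (Vw : forall q, tube D q ->
  Dwb a (snd q) * (fst q * Cconj (fst q))
             + (Dwb b (snd q) * (fst q * fst q) + Dwb c (snd q) * fst q)
             + Cconj (Dw b (snd q) * (fst q * fst q) + Dw c (snd q) * fst q)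
             + Dwb d (snd q)
  = dbar cw (fun q => RtoC (u q)) q).
{ intros q Hq. now rewrite (wirtinger_dbar _ _ _ _ cw (wirtinger_u _ _ _ _ _ _ q HQ Hq)). }
repeat split.
1: rewrite (Hbar cz cz _ _ _ Vz ltac:(wirt)).
2: rewrite (Hbar cz cw _ _ _ Vw ltac:(wirt)).
3: rewrite (Hbar cw cz _ _ _ Vz ltac:(wirt)).
4: rewrite (Hbar cw cw _ _ _ Vw ltac:(wirt)).
all: simpl; subst z w;
  rewrite ?Cplus_conj, ?Cmult_conj, ?Cplus_conj, ?Cmult_conj, ?Cconj_RtoC; ring.
Qed.

(** * The curvature and the determinant of the Hessian *)

(** Only the summand g^{ww*} |d_z g_{zw*}|^2 survives: [g cz cz] depends on w
    alone, so its second derivative and the summands with si or ta equal to [cz]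
    vanish. *)
Lemma curvature_zzzz D a b c d u p :
  quadratic_potential D a b c d u -> tube D p ->
  det (complex_hessian u) p = 1 ->
  curvature (complex_hessian u) cz cz cz cz p
  = 4 * a (snd p) * (Dwb b (snd p) * Cconj (Dwb b (snd p))).
Proof.
intros HQ Hp Hdet. destruct (HQ) as [HD Ha Hb Hc Hd _].
pose proof (open_tube D HD) as HT.
pose proof (fun q => hessian_u D a b c d u q HQ) as Hess. simpl in Hess.
assert (Wzz : forall q, tube D q -> wirtinger (complex_hessian u cz cz) q
                (in_w (Dw a (snd q))) (in_w (Dwb a (snd q)))).
{ intros q Hq. apply (wirtinger_ext (tube D) (fun q => a (snd q))); trivial.
  - intros q' Hq'. exact (eq_sym (proj1 (Hess q' Hq'))).
  - now apply (wirtinger_w D). }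
assert (Dzw : d_ cz (complex_hessian u cz cw) p = Dwb b (snd p) + Dwb b (snd p)).
{ erewrite wirtinger_d; cycle 1.
  - apply (wirtinger_ext (tube D) (fun q => Dwb a (snd q) * Cconj (fst q)
      + (Dwb b (snd q) * fst q + Dwb b (snd q) * fst q) + Dwb c (snd q))); trivial.
    + intros q Hq. exact (eq_sym (proj1 (proj2 (Hess q Hq)))).
    + wirt.
  - simpl. apply injective_projections; simpl; ring. }
assert (Dwz : dbar cz (complex_hessian u cw cz) p
              = Cconj (Dwb b (snd p) + Dwb b (snd p))).
{ erewrite wirtinger_dbar; cycle 1.
  - apply (wirtinger_ext (tube D) (fun q => Dw a (snd q) * fst q
      + Cconj (Dwb b (snd q) * fst q + Dwb b (snd q) * fst q + Dwb c (snd q)))); trivial.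
    + intros q Hq. exact (eq_sym (proj1 (proj2 (proj2 (Hess q Hq))))).
    + wirt.
  - simpl. apply injective_projections; simpl; ring. }
assert (Dzz : d_ cz (dbar cz (complex_hessian u cz cz)) p = 0).
{ erewrite wirtinger_d; cycle 1.
  - apply (wirtinger_ext (tube D) (fun _ => 0)); trivial.
    + intros q Hq. symmetry. exact (wirtinger_dbar _ _ _ _ cz (Wzz q Hq)).
    + apply wirtinger_const.
  - reflexivity. }
unfold curvature, sum_coord.
rewrite Dzz, Dzw, Dwz, (wirtinger_d _ _ _ _ cz (Wzz p Hp)),
  (wirtinger_dbar _ _ _ _ cz (Wzz p Hp)).
simpl. rewrite Hdet, Cplus_conj. destruct (Hess p Hp) as [-> _]. field.
Qed.

(** The six coefficients of [det - 1] as a polynomial in z and its conjugate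
    vanish; the two that matter are those of |z|^2 and of z. *)
Lemma det_coefficients D a b c d u w :
  quadratic_potential D a b c d u ->
  (forall p, tube D p -> det (complex_hessian u) p = 1) ->
  D w ->
  a w * Dw (Dwb a) w
    = Dwb a w * Dw a w + 4 * (Dwb b w * Cconj (Dwb b w)) /\
  a w * Dw (Dwb c) w
    = 2 * (Dwb b w * Cconj (Dwb c w)) + Dwb c w * Dw a w.
Proof.
intros HQ Hdet Hw.
destruct (quadratic_coefficients
  (a w * Dw (Dwb a) w - (Dwb a w * Dw a w + 4 * (Dwb b w * Cconj (Dwb b w))))
  (a w * Dw (Dwb b) w - 2 * Dwb b w * Dw a w)
  (a w * Cconj (Dwb (Dw b) w) - 2 * Dwb a w * Cconj (Dwb b w))
  (a w * Dw (Dwb c) w - (2 * (Dwb b w * Cconj (Dwb c w)) + Dwb c w * Dw a w))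
  (a w * Cconj (Dwb (Dw c) w)
   - (2 * Dwb c w * Cconj (Dwb b w) + Dwb a w * Cconj (Dwb c w)))
  (a w * Dw (Dwb d) w - Dwb c w * Cconj (Dwb c w) - 1)) as [E1 E2].
- intros z. pose proof (Hdet (z, w) Hw) as E. unfold det in E.
  destruct (hessian_u D a b c d u (z, w) HQ Hw) as (E1 & E2 & E3 & E4).
  rewrite E1, E2, E3, E4 in E. simpl in E.
  rewrite !Cplus_conj, !Cmult_conj in E.
  refine (eq_trans _ (proj1 (Ceq_minus _ _) E)). ring.
- split; apply Ceq_minus; assumption.
Qed.

(** With [Dwb b] equal to zero, the determinant identities become the vanishing
    of the numerators in the quotient rule for [Dw kappa] and [Dw mu]. *)
Lemma flat_of_holomorphic D a b c d u :
  quadratic_potential D a b c d u ->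
  (forall w, D w -> a w <> 0) -> (forall w, D w -> Cconj (a w) = a w) ->
  (forall p, tube D p -> det (complex_hessian u) p = 1) ->
  (forall w, D w -> Dwb b w = 0) ->
  flat (tube D) (complex_hessian u).
Proof.
intros HQ Ha0 HaR Hdet Hb0. destruct (HQ) as [HD Ha Hb Hc Hd _].
set (kappa := fun w => Dwb a w / a w).
set (mu := fun w => Dwb c w / a w).
assert (Hk : smooth D kappa).
{ apply smooth_div; auto using smooth_Dwb. }
assert (Hm : smooth D mu).
{ apply smooth_div; auto using smooth_Dwb. }
assert (Dk : forall w, D w -> Dw kappa w = 0).
{ intros w Hw. apply (Dw_div_eq_0 D); auto using smooth_Dwb.
  rewrite (proj1 (det_coefficients _ _ _ _ _ _ w HQ Hdet Hw)), Hb0 by exact Hw.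
  ring. }
assert (Dm : forall w, D w -> Dw mu w = 0).
{ intros w Hw. apply (Dw_div_eq_0 D); auto using smooth_Dwb.
  rewrite (proj2 (det_coefficients _ _ _ _ _ _ w HQ Hdet Hw)), Hb0 by exact Hw.
  ring. }
assert (Dk' : forall w, D w -> Dw (Dwb kappa) w = 0)
  by (intros; now apply (Dwb_antiholomorphic D)).
assert (Dm' : forall w, D w -> Dw (Dwb mu) w = 0)
  by (intros; now apply (Dwb_antiholomorphic D)).
apply (flat_of_antiholomorphic_frame (tube D) _ (fun q => a (snd q))
  (fun q => kappa (snd q) * Cconj (fst q) + mu (snd q))
  (fun j q => in_w (kappa (snd q)) j)
  (fun j q => match j with
     | cz => kappa (snd q)
     | cw => Dwb kappa (snd q) * Cconj (fst q) + Dwb mu (snd q) end)).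
- now apply open_tube.
- intros p Hp. now apply Ha0.
- intros p Hp. pose proof (Ha0 _ Hp) as Hap. pose proof (HaR _ Hp) as HaRp.
  eapply wirtinger_eq; [wirt| |]; intros [|]; simpl; rewrite ?Cconj_RtoC; try ring;
    unfold kappa.
  + rewrite (Dw_real D), Cdiv_conj, HaRp by assumption. now field.
  + now field.
- intros p Hp.
  eapply wirtinger_eq; [wirt| |]; intros [|]; simpl; rewrite ?Cconj_RtoC, ?Dk, ?Dm;
    trivial; ring.
- intros [|] p Hp; simpl.
  + exact (ex_intro _ _ (wirtinger_const 0 p)).
  + eexists. eapply wirtinger_eq; [wirt| |reflexivity].
    intros [|]; simpl; rewrite ?Dk; trivial.
- intros [|] p Hp.
  + eexists. eapply wirtinger_eq; [wirt| |reflexivity].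
    intros [|]; simpl; rewrite ?Dk; trivial.
  + eexists. eapply wirtinger_eq; [wirt| |reflexivity].
    intros [|]; simpl; rewrite ?Cconj_RtoC, ?Dk', ?Dm'; trivial; ring.
- intros p Hp. pose proof (Ha0 _ Hp) as Hap. pose proof (HaR _ Hp) as HaRp.
  destruct (hessian_u _ _ _ _ _ _ p HQ Hp) as (E1 & E2 & E3 & _).
  assert (Ezw : complex_hessian u cz cw p
    = a (snd p) * (kappa (snd p) * Cconj (fst p) + mu (snd p))).
  { rewrite E2, Hb0 by exact Hp. unfold kappa, mu. now field. }
  assert (Ewz : complex_hessian u cw cz p
    = a (snd p) * Cconj (kappa (snd p) * Cconj (fst p) + mu (snd p))).
  { rewrite E3, Hb0, (Dw_real D) by assumption. unfold kappa, mu.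
    rewrite !Cplus_conj, !Cmult_conj, !Cdiv_conj, HaRp, Cconj_conj, Cconj_RtoC by trivial.
    now field. }
  repeat split; trivial.
  (* The last entry is determined by the other three and det g = 1. *)
  pose proof (Hdet p Hp) as E. unfold det in E. rewrite E1, Ezw, Ewz in E.
  set (s := kappa (snd p) * Cconj (fst p) + mu (snd p)) in *.
  apply Ceq_minus.
  replace (_ - _) with
    ((a (snd p) * complex_hessian u cw cw p - a (snd p) * s * (a (snd p) * Cconj s) - 1)
     / a (snd p)) by now field.
  rewrite E. now field.
Qed.

Theorem theorem1p1
  (D : C -> Prop) (hD : is_domain D)
  (a d : C -> R) (b c : C -> C)
  (ha : smooth D (fun w => RtoC (a w))) (hb : smooth D b)
  (hc : smooth D c) (hd : smooth D (fun w => RtoC (d w)))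
  (ha_pos : forall w, D w -> (0 < a w)%R)
  (u : C * C -> R)
  (hu : forall z w : C, D w ->
     RtoC (u (z, w)) =
       RtoC (a w) * RtoC (Cmod z ^ 2) + b w * (z * z) + Cconj (b w * (z * z))
       + c w * z + Cconj (c w * z) + RtoC (d w))
  (hpsh : plurisubharmonic (tube D) u)
  (hdet : forall p : C * C, tube D p -> det (complex_hessian u) p = 1) :
  flat (tube D) (complex_hessian u) <-> holomorphic D b.
Proof.
destruct hD as [HD _].
assert (HQ : quadratic_potential D (fun w => RtoC (a w)) b c (fun w => RtoC (d w)) u).
{ split; trivial. intros z w Hw.
  rewrite hu, Cmod2_conj, Cplus_conj by exact Hw. ring. }
assert (Ha0 : forall w, D w -> RtoC (a w) <> 0).
{ intros w Hw E. apply RtoC_inj in E. specialize (ha_pos w Hw). lra. }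
rewrite (holomorphic_iff_Dwb D b HD hb). split.
- intros Hflat w Hw.
  pose proof (curvature_zzzz _ _ _ _ _ _ (RtoC 0, w) HQ Hw (hdet (RtoC 0, w) Hw)) as E.
  rewrite (Hflat (RtoC 0, w) Hw) in E. simpl in E.
  rewrite <- Cmod2_conj in E.
  apply Cmod_eq_0. apply (f_equal Re) in E. simpl in E.
  assert (E' : (a w * (Cmod (Dwb b w) * Cmod (Dwb b w)) = 0)%R) by lra.
  specialize (ha_pos w Hw).
  apply Rmult_integral in E' as [E'|E']; [lra|].
  apply Rmult_integral in E'. tauto.
- intros Hb. apply (flat_of_holomorphic D _ b c _ u HQ); trivial.
  intros w _. apply Cconj_RtoC.
Qed.
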